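(* Fix $n\ge 0$. Let $S_n$ be the collection of localizations of all truth tables of modalities of $TL_n$. Then: (1) For models $M=M_k$ and $M'=M_l$: if there is a formula of $TL_n$ (built with the single predicate name $P$) that is equivalent to different trivial formulas in $M$ and in $M'$, then there is also a formula of $S_n$ that is equivalent to different trivial formulas in $M$ and in $M'$. (2) There are finitely many formulas in $S_n$ such that every formula of $S_n$ is logically equivalent to one of them. (3) There are models $M_k$ and $M_l$ with $k\ne l$ such that every formula of $TL_n$ is equivalent to the same trivial formula in both models. (4) There are integers $k$ such that $C_k(X)$ is not expressible in $TL_n$ over the real line.
   Context: For each integer $k>0$, $M_k$ is the structure $\langle\mathbb{R},<,B,P\rangle$ with $B(t,s)$ iff $s=t+1$ and $P=\{m/k: m\in\mathbb{Z}\}$; ''a model'' means some $M_k$. $L_n$ is the set of formulas of quantifier depth at most $n$ (counting both first-order and monadic second-order quantifiers) of second-order monadic logic of order with $<$, $B$ and $P$ (atomic formulas $t_1<t_2$, $t_1=t_2$, $B(t_1,t_2)$, $P(t)$, $X(t)$). A truth table for a $k$-ary modality $O$ is a formula $\overline O(t_0,X_1,\dots,X_k)$ with one free first-order variable $t_0$ and free predicate variables $X_1,\dots,X_k$. $TL_n$ is the temporal logic whose modalities are all modalities having a truth table in $L_n$; its formulas are given by $\varphi::=\mathit{True}\mid P\mid\neg\varphi\mid\varphi\wedge\varphi\mid O(\varphi_1,\dots,\varphi_k)$, and $O(\varphi_1,\dots,\varphi_k)$ holds at $t$ in a model iff $\overline O(t,A_{\varphi_1},\dots,A_{\varphi_k})$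 holds, where $A_{\varphi_i}$ is the set of points where $\varphi_i$ holds. The trivial temporal formulas are $\mathit{True},\mathit{False},P,\neg P$ and the trivial first-order formulas are $\mathit{True},\mathit{False},P(t_0),\neg P(t_0)$; a formula is equivalent to a trivial formula in a model if they hold at exactly the same points of that model. The localizations of a formula $\varphi(t_0,X_1,\dots,X_k)$ are the $4^k$ formulas $\varphi(t_0,T_1,\dots,T_k)$ obtained by substituting for each $X_i$ one of the trivial predicates $P$, $\neg P$, $\mathit{True}$, $\mathit{False}$ (i.e. replacing each $X_i(t)$ by $P(t)$, $\neg P(t)$, $\mathit{True}$ or $\mathit{False}$). The counting modality $C_k(X)$ holds at $t_0$ iff there are at least $k$ distinct points $t$ with $t_0<t<t_0+1$ and $X(t)$; $C_k(X)$ is expressible in $TL_n$ over the real line if some $TL_n$ formula holds at exactly the same points as $C_k(X)$ for every interpretation of the predicates on $\mathbb{R}$. *)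

(* Defs.v *)
From mathcomp Require Import all_boot all_order all_algebra.
From mathcomp Require Import reals.

Set Implicit Arguments.
Unset Strict Implicit.
Unset Printing Implicit Defensive.

Import Order.TTheory GRing.Theory Num.Theory.
Local Open Scope ring_scope.

(* Monadic second-order formulas in well-scoped de Bruijn form: [mso m p] has
   its free first-order variables among 'I_m and its free set variables among
   'I_p; a quantifier binds variable [ord0] of its sort and shifts the others.
   The other connectives and the universal quantifiers are the usual classical
   abbreviations, which do not change the quantifier depth. *)
Inductive mso : nat -> nat -> Type :=
| FTrue m p : mso m p
| FLt m p (i j : 'I_m) : mso m p
| FEq m p (i j : 'I_m) : mso m p
| FB m p (i j : 'I_m) : mso m p
| FP m p (i : 'I_m) : mso m p
| FX m p (X : 'I_p) (i : 'I_m) : mso m p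
| FNot m p (f : mso m p) : mso m p
| FAnd m p (f g : mso m p) : mso m p
| FEx1 m p (f : mso m.+1 p) : mso m p
| FEx2 m p (f : mso m p.+1) : mso m p.

Arguments FTrue {m p}.
Arguments FLt {m p} i j.
Arguments FEq {m p} i j.
Arguments FB {m p} i j.
Arguments FP {m p} i.
Arguments FX {m p} X i.

Fixpoint qdepth m p (f : mso m p) : nat :=
  match f with
  | FNot _ _ f => qdepth f
  | FAnd _ _ f g => maxn (qdepth f) (qdepth g)
  | FEx1 _ _ f => (qdepth f).+1
  | FEx2 _ _ f => (qdepth f).+1
  | _ => 0%N
  end.

Record structure := Structure {
  dom :> Type;
  s_lt : dom -> dom -> Prop;
  s_B : dom -> dom -> Prop;
  s_P : dom -> Prop }.

Definition scons T m (x : T) (e : 'I_m -> T) : 'I_m.+1 -> T :=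
  fun i => oapp e x (unlift ord0 i).

Fixpoint sat (M : structure) m p (f : mso m p) :
    ('I_m -> M) -> ('I_p -> M -> Prop) -> Prop :=
  match f with
  | FTrue _ _ => fun _ _ => True
  | FLt _ _ i j => fun e _ => s_lt (e i) (e j)
  | FEq _ _ i j => fun e _ => e i = e j
  | FB _ _ i j => fun e _ => s_B (e i) (e j)
  | FP _ _ i => fun e _ => s_P (e i)
  | FX _ _ X i => fun e E => E X (e i)
  | FNot _ _ f => fun e E => ~ sat f e E
  | FAnd _ _ f g => fun e E => sat f e E /\ sat g e E
  | FEx1 _ _ f => fun e E => exists x : M, sat f (scons x e) E
  | FEx2 _ _ f => fun e E => exists A : M -> Prop, sat f e (scons A E)
  end.

(* A truth table of a k-ary modality: the variable [ord0 : 'I_1] is t_0. *)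
Definition truth_table (k : nat) := mso 1 k.

Definition tt_sat (M : structure) k (phi : truth_table k)
    (t : M) (A : 'I_k -> M -> Prop) : Prop :=
  sat phi (fun=> t) A.

(* Formulas of TL_n over the predicate name P and further predicate names taken
   from V; a modality is given by its truth table. *)
Inductive tl (n : nat) (V : Type) : Type :=
| TTrue
| TP
| TVar (v : V)
| TNot (f : tl n V)
| TAnd (f g : tl n V)
| TMod (k : nat) (phi : truth_table k) (hphi : (qdepth phi <= n)%N)
    (a : 'I_k -> tl n V).

Arguments TTrue {n V}.
Arguments TP {n V}.

Fixpoint tl_sat (M : structure) n V (I : V -> M -> Prop) (f : tl n V) :
    M -> Prop :=
  match f with
  | TTrue => fun=> True
  | TP => fun t => s_P t
  | TVar v => fun t => I v t
  | TNot f => fun t => ~ tl_sat I f t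
  | TAnd f g => fun t => tl_sat I f t /\ tl_sat I g t
  | TMod _ phi _ a => fun t => tt_sat phi t (fun i => tl_sat I (a i))
  end.

(* TL_n over the single predicate name P. *)
Definition tlP (n : nat) := tl n void.

Definition tlP_sat (M : structure) n (f : tlP n) : M -> Prop :=
  tl_sat (fun v : void => of_void (M -> Prop) v) f.

Inductive trivial := TrTrue | TrFalse | TrP | TrNotP.

Definition trivial_tl n (c : trivial) : tlP n :=
  match c with
  | TrTrue => TTrue
  | TrFalse => TNot TTrue
  | TrP => TP
  | TrNotP => TNot TP
  end.

Definition trivial_mso m p (c : trivial) (i : 'I_m) : mso m p :=
  match c with
  | TrTrue => FTrue
  | TrFalse => FNot FTrue
  | TrP => FP i
  | TrNotP => FNot (FP i)
  end.

Definition tl_equiv_trivial (M : structure) n (f : tlP n) (c : trivial) :=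
  forall t : M, tlP_sat f t <-> tlP_sat (trivial_tl n c) t.

Definition no_sets (M : structure) : 'I_0 -> M -> Prop := fun=> fun=> False.

Definition mso_equiv_trivial (M : structure) (f : mso 1 0) (c : trivial) :=
  forall t : M, tt_sat f t (@no_sets M)
            <-> tt_sat (trivial_mso 0 c ord0) t (@no_sets M).

Definition tl_differ n (M M' : structure) (f : tlP n) :=
  exists c c', [/\ c <> c', tl_equiv_trivial M f c & tl_equiv_trivial M' f c'].

Definition mso_differ (M M' : structure) (f : mso 1 0) :=
  exists c c',
    [/\ c <> c', mso_equiv_trivial M f c & mso_equiv_trivial M' f c'].

(* A free set variable is replaced by a trivial predicate ([inl]) or renamed
   ([inr]); bound set variables are left alone. *)
Definition lift_subst p q (s : 'I_p -> trivial + 'I_q) :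
    'I_p.+1 -> trivial + 'I_q.+1 :=
  scons (inr ord0)
    (fun X => match s X with
              | inl c => inl c
              | inr Y => inr (lift ord0 Y)
              end).

Fixpoint subst m p (f : mso m p) :
    forall q, ('I_p -> trivial + 'I_q) -> mso m q :=
  match f in mso m p return forall q, ('I_p -> trivial + 'I_q) -> mso m q with
  | FTrue _ _ => fun _ _ => FTrue
  | FLt _ _ i j => fun _ _ => FLt i j
  | FEq _ _ i j => fun _ _ => FEq i j
  | FB _ _ i j => fun _ _ => FB i j
  | FP _ _ i => fun _ _ => FP i
  | FX _ _ X i => fun q s =>
      match s X with
      | inl c => trivial_mso q c i
      | inr Y => FX Y i
      end
  | FNot _ _ f => fun _ s => FNot (subst f s)
  | FAnd _ _ f g => fun _ s => FAnd (subst f s) (subst g s)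
  | FEx1 _ _ f => fun _ s => FEx1 (subst f s)
  | FEx2 _ _ f => fun _ s => FEx2 (subst f (lift_subst s))
  end.

Definition localize k (phi : truth_table k) (s : 'I_k -> trivial) : mso 1 0 :=
  subst phi (fun X => inl (s X)).

Definition in_S (n : nat) (f : mso 1 0) : Prop :=
  exists k (phi : truth_table k) (s : 'I_k -> trivial),
    (qdepth phi <= n)%N /\ f = localize phi s.

Definition logically_equivalent (f g : mso 1 0) : Prop :=
  forall (M : structure) (t : M),
    tt_sat f t (@no_sets M) <-> tt_sat g t (@no_sets M).

Definition real_line (R : realType) (P : R -> Prop) : structure :=
  @Structure R (fun x y => x < y) (fun t s => s = t + 1) P.

Definition model (R : realType) (k : nat) : structure :=
  real_line (fun x : R => exists m : int, x = m%:~R / k%:R).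

Definition counting (R : realType) (k : nat) (X : R -> Prop) (t0 : R) : Prop :=
  exists t : 'I_k -> R,
    injective t /\ forall i, t0 < t i < t0 + 1 /\ X (t i).

(* Besides P there are predicate names X_0, X_1, ...; the X of C_k(X) is X_0. *)
Definition counting_expressible (R : realType) (n k : nat) : Prop :=
  exists f : tl n nat,
  forall (P : R -> Prop) (I : nat -> R -> Prop) (t : R),
    @tl_sat (real_line P) n nat I f t <-> counting k (I 0%N) t.

(* Main.v *)
(** Up to logical equivalence there are finitely many formulas of depth at most
   [n], by induction on [n]: such a formula is a Boolean combination of atoms and
   of quantified representatives of smaller depth. The automorphism group of
   [M_k] has just two orbits, [P] and its complement: after rescaling [P] to the
   integers, points are moved by integer translations and by maps that preserve
   integer parts and act on all fractional parts by the same Moebius map. So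
   every formula over [P] alone is trivial in [M_k], and if all localizations
   have the same trivial form in two models, an induction on temporal formulas
   shows that so do all formulas of [TL_n]. By pigeonhole this happens for some
   [k < l]; but [C_l(P)] is false everywhere in [M_k] and true off [P] in [M_l]. *)

Require Import Defs.
From mathcomp Require Import all_boot all_order all_algebra.
From mathcomp Require Import boolp reals.
From mathcomp Require Import ring lra zify.
From Stdlib Require List.

Set Implicit Arguments.
Unset Strict Implicit.
Unset Printing Implicit Defensive.

Import Order.TTheory GRing.Theory Num.Theory.
Local Open Scope ring_scope.

(** * Extended environments *)

Lemma scons0 T m (x : T) (e : 'I_m -> T) : scons x e ord0 = x.
Proof. by rewrite /scons unlift_none. Qed.

Lemma scons_lift T m (x : T) (e : 'I_m -> T) i : scons x e (lift ord0 i) = e i.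
Proof. by rewrite /scons liftK. Qed.

Lemma ord_cases m (Q : 'I_m.+1 -> Prop) :
  Q ord0 -> (forall i, Q (lift ord0 i)) -> forall i, Q i.
Proof. by move=> Q0 QS i; case: (unliftP ord0 i) => [j|] ->. Qed.

(** * Finitely many formulas of bounded depth *)

Definition mso_equiv m p (f g : mso m p) : Prop :=
  forall (M : structure) (e : 'I_m -> M) (E : 'I_p -> M -> Prop),
    sat f e E <-> sat g e E.

(** Lists of formulas use [List.In], since [mso] is given no [eqType] structure. This lemma carries
    boolean membership in an enumeration of indices over to them. *)
Lemma In_map (A : eqType) B (f : A -> B) (x : A) (s : seq A) :
  x \in s -> List.In (f x) (map f s).
Proof.
elim: s => //= a s IH; rewrite inE => /orP[/eqP ->|/IH ?]; [by left | by right].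
Qed.

Lemma In_nth A (d x : A) (s : seq A) :
  List.In x s -> exists i : 'I_(size s), nth d s i = x.
Proof.
elim: s => //= a s IH [->|/IH [i <-]]; first by exists ord0.
by exists (lift ord0 i).
Qed.

Lemma nth_In A (d : A) (s : seq A) i : (i < size s)%N -> List.In (nth d s i) s.
Proof. by elim: s i => //= a s IH [|i] /=; [left | move=> /IH; right]. Qed.

Definition FIte m p (a f g : mso m p) : mso m p :=
  FAnd (FNot (FAnd a (FNot f))) (FNot (FAnd (FNot a) (FNot g))).

Lemma sat_FIte (M : structure) m p (a f g : mso m p) e (E : 'I_p -> M -> Prop) :
  sat (FIte a f g) e E <-> (sat a e E /\ sat f e E) \/ (~ sat a e E /\ sat g e E).
Proof.
rewrite /=; have := EM (sat a e E); have := EM (sat f e E).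
by have := EM (sat g e E); tauto.
Qed.

Lemma sat_FNot (M : structure) m p (f : mso m p) e (E : 'I_p -> M -> Prop) :
  sat (FNot f) e E = ~ sat f e E.
Proof. by []. Qed.

Lemma sat_FAnd (M : structure) m p (f g : mso m p) e (E : 'I_p -> M -> Prop) :
  sat (FAnd f g) e E = (sat f e E /\ sat g e E).
Proof. by []. Qed.

(** These are the complete decision trees that test the members of [s] in order, with constants at
    the leaves. Every Boolean function of [s] is one of them, so no normal form has to be
    computed. *)
Fixpoint bool_comb m p (s : seq (mso m p)) : seq (mso m p) :=
  if s is a :: s' then
    List.flat_map (fun f => List.map (FIte a f) (bool_comb s')) (bool_comb s')
  else [:: FTrue; FNot FTrue].

Definition represented m p (s : seq (mso m p)) (f : mso m p) : Prop :=
  exists g, List.In g s /\ mso_equiv f g.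

Lemma bool_comb_cons m p (a f g : mso m p) s :
  List.In f (bool_comb s) -> List.In g (bool_comb s) ->
  List.In (FIte a f g) (bool_comb (a :: s)).
Proof.
by move=> fs gs; apply/List.in_flat_map; exists f; split=> //; apply: List.in_map.
Qed.

Lemma bool_comb_inv m p (a h : mso m p) s :
  List.In h (bool_comb (a :: s)) ->
  exists f g, [/\ h = FIte a f g, List.In f (bool_comb s) & List.In g (bool_comb s)].
Proof.
move=> /List.in_flat_map[f [fs /List.in_map_iff[g [<- gs]]]].
by exists f, g.
Qed.

Lemma bool_comb_depth m p n (s : seq (mso m p)) :
  (forall f, List.In f s -> qdepth f <= n)%N ->
  (forall f, List.In f (bool_comb s) -> qdepth f <= n)%N.
Proof.
elim: s => [_ f [<-|[<-|[]]] //|a s IH sn h].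
move=> /bool_comb_inv[f [g [-> fs gs]]] /=.
have an : (qdepth a <= n)%N by apply: sn; left.
have {}IH := IH (fun f fs => sn f (or_intror fs)).
by rewrite !geq_max an (IH f fs) (IH g gs).
Qed.

Lemma bool_comb_true m p (s : seq (mso m p)) : represented (bool_comb s) FTrue.
Proof.
elim: s => [|a s [f [fs ef]]]; first by exists FTrue; split; [left|].
exists (FIte a f f); split; first exact: bool_comb_cons.
move=> M e E; rewrite sat_FIte -(ef M e E) /=.
by have := EM (sat a e E); tauto.
Qed.

(** Negation passes through each test down to the leaves, where it swaps the two constants. *)
Lemma bool_comb_not m p (s : seq (mso m p)) f :
  List.In f (bool_comb s) -> represented (bool_comb s) (FNot f).
Proof.
elim: s f => [f|a s IH h].
  case=> [<-|[<-|[]]]; last by exists FTrue; split; [left|move=> M e E /=; tauto].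
  by exists (FNot FTrue); split; [right; left|].
move=> /bool_comb_inv[f [g [-> /IH [f' [f's ef]] /IH [g' [g's eg]]]]].
exists (FIte a f' g'); split; first exact: bool_comb_cons.
move=> M e E; rewrite sat_FNot !sat_FIte.
have /= <- := ef M e E; have /= <- := eg M e E.
by have := EM (sat a e E); tauto.
Qed.

(** Both trees test the same formulas in the same order, so the conjunction can be taken branch by
    branch. *)
Lemma bool_comb_and m p (s : seq (mso m p)) f g :
  List.In f (bool_comb s) -> List.In g (bool_comb s) ->
  represented (bool_comb s) (FAnd f g).
Proof.
elim: s f g => [f g|a s IH h h'].
  have T : List.In FTrue (bool_comb (@nil (mso m p))) by left.
  have F : List.In (FNot FTrue) (bool_comb (@nil (mso m p))) by right; left.
  case=> [<-|[<-|[]]]; case=> [<-|[<-|[]]]; [exists FTrue|..];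
    try (exists (FNot FTrue)); split=> // M e E /=; tauto.
move=> /bool_comb_inv[f [g [-> fs gs]]] /bool_comb_inv[f' [g' [-> f's g's]]].
have [f'' [f''s ef]] := IH _ _ fs f's; have [g'' [g''s eg]] := IH _ _ gs g's.
exists (FIte a f'' g''); split; first exact: bool_comb_cons.
move=> M e E; rewrite sat_FAnd !sat_FIte.
have /= <- := ef M e E; have /= <- := eg M e E.
by have := EM (sat a e E); tauto.
Qed.

Lemma bool_comb_atom m p (s : seq (mso m p)) f :
  List.In f s -> represented (bool_comb s) f.
Proof.
elim: s => //= a s IH [<-|/IH [g [gs eg]]]; last first.
  (* Equal branches make the test on [a] irrelevant. *)
  exists (FIte a g g); split; first exact: bool_comb_cons.
  by move=> M e E; rewrite sat_FIte -(eg M e E); have := EM (sat a e E); tauto.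
(* The head [a] itself is the tree with a true branch where [a] holds and a false branch
   elsewhere. *)
have [g [gs eg]] := bool_comb_true s; have [h [hs eh]] := bool_comb_not gs.
exists (FIte a g h); split; first exact: bool_comb_cons.
move=> M e E; rewrite sat_FIte -(eh M e E) /= -(eg M e E) /=.
by have := EM (sat a e E); tauto.
Qed.

Definition atoms m p : seq (mso m p) :=
  [seq FLt x.1 x.2 | x <- enum {: 'I_m * 'I_m}] ++
  [seq FEq x.1 x.2 | x <- enum {: 'I_m * 'I_m}] ++
  [seq FB x.1 x.2 | x <- enum {: 'I_m * 'I_m}] ++
  [seq FP x | x <- enum 'I_m] ++
  [seq FX x.1 x.2 | x <- enum {: 'I_p * 'I_m}].

(** Quantified representatives of the previous depth serve as further atoms. Below a quantifier one
    more variable is free, so [m] and [p] vary in the recursion. *)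
Fixpoint depth_reps n m p : seq (mso m p) :=
  bool_comb (atoms m p ++
    if n is n'.+1 then
      List.map (@FEx1 m p) (depth_reps n' m.+1 p) ++
      List.map (@FEx2 m p) (depth_reps n' m p.+1)
    else [::]).

Lemma atoms_depth m p f : List.In f (atoms m p) -> qdepth f = 0%N.
Proof.
by do ![move=> /List.in_app_iff[]|move=> /List.in_map_iff[? [<- _]] //].
Qed.

Lemma depth_reps_depth n m p f : List.In f (depth_reps n m p) -> (qdepth f <= n)%N.
Proof.
elim: n m p f => [|n IH] m p f /=; apply: bool_comb_depth => {}f.
  by move=> /List.in_app_iff[/atoms_depth ->|[]].
move=> /List.in_app_iff[/atoms_depth -> //|].
by move=> /List.in_app_iff[] /List.in_map_iff[g [<- /IH]].
Qed.

Definition depth_atoms n m p : seq (mso m p) :=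
  atoms m p ++
    if n is n'.+1 then
      List.map (@FEx1 m p) (depth_reps n' m.+1 p) ++
      List.map (@FEx2 m p) (depth_reps n' m p.+1)
    else [::].

Lemma depth_repsE n m p : depth_reps n m p = bool_comb (depth_atoms n m p).
Proof. by case: n. Qed.

Lemma depth_atoms_rep n m p f :
  List.In f (depth_atoms n m p) -> represented (depth_reps n m p) f.
Proof. by rewrite depth_repsE; apply: bool_comb_atom. Qed.

Lemma atoms_rep n m p f : List.In f (atoms m p) -> represented (depth_reps n m p) f.
Proof. by move=> ?; apply: depth_atoms_rep; apply/List.in_app_iff; left. Qed.

Lemma mso_equiv_trans m p (f g h : mso m p) :
  mso_equiv f g -> mso_equiv g h -> mso_equiv f h.
Proof. by move=> fg gh M e E; rewrite (fg M e E) (gh M e E). Qed.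

Lemma represented_equiv m p s (f g : mso m p) :
  mso_equiv f g -> represented s g -> represented s f.
Proof.
by move=> fg [h [hs gh]]; exists h; split=> //; apply: mso_equiv_trans gh.
Qed.

(** Equivalence is a congruence for all connectives and quantifiers. Immediate subformulas can
    therefore be replaced by representatives first, which leaves a Boolean combination of trees or a
    quantified representative. *)
Lemma depth_reps_complete n m p (f : mso m p) :
  (qdepth f <= n)%N -> represented (depth_reps n m p) f.
Proof.
elim: f n => {m p} [m p|m p i j|m p i j|m p i j|m p i|m p X i|m p f IHf|m p f IHf g IHg
  |m p f IHf|m p f IHf] n.
- by rewrite depth_repsE => _; apply: bool_comb_true.
- move=> _; apply: atoms_rep; rewrite /atoms !List.in_app_iff; left.
  by apply: (In_map (fun x => FLt x.1 x.2) (x := (i, j))); rewrite mem_enum.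
- move=> _; apply: atoms_rep; rewrite /atoms !List.in_app_iff; right; left.
  by apply: (In_map (fun x => FEq x.1 x.2) (x := (i, j))); rewrite mem_enum.
- move=> _; apply: atoms_rep; rewrite /atoms !List.in_app_iff; do 2!right; left.
  by apply: (In_map (fun x => FB x.1 x.2) (x := (i, j))); rewrite mem_enum.
- move=> _; apply: atoms_rep; rewrite /atoms !List.in_app_iff; do 3!right; left.
  by apply: In_map; rewrite mem_enum.
- move=> _; apply: atoms_rep; rewrite /atoms !List.in_app_iff; do 4!right.
  by apply: (In_map (fun x => FX x.1 x.2) (x := (X, i))); rewrite mem_enum.
- move=> /IHf[f' [f's ff']]; apply: (@represented_equiv _ _ _ _ (FNot f')).
    by move=> M e E /=; rewrite (ff' M e E).
  by move: f's; rewrite depth_repsE; apply: bool_comb_not.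
- rewrite /= geq_max => /andP[/IHf[f' [f's ff']] /IHg[g' [g's gg']]].
  apply: (@represented_equiv _ _ _ _ (FAnd f' g')).
    by move=> M e E /=; rewrite (ff' M e E) (gg' M e E).
  by move: f's g's; rewrite depth_repsE; apply: bool_comb_and.
- case: n => //= n /IHf[f' [f's ff']].
  apply: (@represented_equiv _ _ _ _ (FEx1 f')).
    by move=> M e E /=; split=> -[x /ff' ?]; exists x.
  apply: (@depth_atoms_rep n.+1); rewrite /depth_atoms !List.in_app_iff; right; left.
  exact: List.in_map.
- case: n => //= n /IHf[f' [f's ff']].
  apply: (@represented_equiv _ _ _ _ (FEx2 f')).
    by move=> M e E /=; split=> -[x /ff' ?]; exists x.
  apply: (@depth_atoms_rep n.+1); rewrite /depth_atoms !List.in_app_iff; do 2!right.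
  exact: List.in_map.
Qed.

(** * Substitution of trivial predicates *)

Lemma trivial_mso_depth m p c (i : 'I_m) : qdepth (trivial_mso p c i) = 0%N.
Proof. by case: c. Qed.

Lemma subst_depth m p (f : mso m p) q (s : 'I_p -> trivial + 'I_q) :
  qdepth (subst f s) = qdepth f.
Proof.
elim: f q s => {m p} //= [m p X i|m p f IHf g IHg|m p f IHf|m p f IHf] q s.
- by case: (s X) => [c|Y] //=; rewrite trivial_mso_depth.
- by rewrite IHf IHg.
- by rewrite IHf.
- by rewrite IHf.
Qed.

Lemma subst_id m p (f : mso m p) (s : 'I_p -> trivial + 'I_p) :
  (forall X, s X = inr X) -> subst f s = f.
Proof.
elim: f s => {m p} //= [m p X i|m p f IHf|m p f IHf g IHg|m p f IHf|m p f IHf] s sK.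
- by rewrite sK.
- by rewrite IHf.
- by rewrite IHf // IHg.
- by rewrite IHf.
- rewrite IHf //; apply: ord_cases => [|X]; rewrite /lift_subst ?scons0 //.
  by rewrite scons_lift sK.
Qed.

Lemma in_S_depth n f : in_S n f -> (qdepth f <= n)%N.
Proof. by case=> k [phi [s [dphi ->]]]; rewrite /localize subst_depth. Qed.

(** With no set variable to replace, [f] is its own localization as the truth table of a 0-ary
    modality. Together with [in_S_depth] this identifies [in_S n] with a depth bound. *)
Lemma depth_in_S n f : (qdepth f <= n)%N -> in_S n f.
Proof.
move=> df; exists 0%N, f, (fun=> TrTrue); split=> //.
by rewrite /localize subst_id // => -[].
Qed.

(** [TrFalse] is [~ True], so that both satisfaction relations convert to this set and the next two
    lemmas are equalities. *)
Definition trivial_set (M : structure) (c : trivial) : M -> Prop :=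
  match c with
  | TrTrue => fun=> True
  | TrFalse => fun=> ~ True
  | TrP => fun t => s_P t
  | TrNotP => fun t => ~ s_P t
  end.

Lemma sat_trivial_mso (M : structure) m p c (i : 'I_m) e (E : 'I_p -> M -> Prop) :
  sat (trivial_mso p c i) e E = trivial_set c (e i).
Proof. by case: c. Qed.

Lemma tlP_sat_trivial (M : structure) n c (t : M) :
  tlP_sat (trivial_tl n c) t = trivial_set c t.
Proof. by case: c. Qed.

Lemma mso_equiv_trivial_set (M : structure) f c (t : M) : mso_equiv_trivial M f c ->
  tt_sat f t (@no_sets M) <-> trivial_set c t.
Proof. by move=> /(_ t) ->; rewrite /tt_sat sat_trivial_mso. Qed.

Lemma sat_subst (M : structure) m p (f : mso m p) q (s : 'I_p -> trivial + 'I_q)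
    (e : 'I_m -> M) E E' :
  (forall X x, E X x <-> match s X with inl c => trivial_set c x
                                      | inr Y => E' Y x end) ->
  sat (subst f s) e E' <-> sat f e E.
Proof.
elim: f q s e E E' => {m p} //= [m p X i|m p f IHf|m p f IHf g IHg|m p f IHf|m p f IHf]
  q s e E E' EE'.
- by rewrite EE'; case: (s X) => //= c; rewrite sat_trivial_mso.
- by rewrite (IHf _ _ _ _ _ EE').
- by rewrite (IHf _ _ _ _ _ EE') (IHg _ _ _ _ _ EE').
- by split=> -[x] /(IHf _ _ _ _ _ EE') ?; exists x.
(* Both environments are extended by the same set [A], which [lift_subst] keeps at index [ord0]. *)
- have ext A X x : scons A E X x <-> match lift_subst s X with
      inl c => trivial_set c x | inr Y => scons A E' Y x end.
    elim/ord_cases: X => [|X]; rewrite /lift_subst ?scons0 //.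
    by rewrite !scons_lift EE'; case: (s X) => // Y; rewrite scons_lift.
  by split=> -[A] /(IHf _ _ _ _ _ (ext A)) ?; exists A.
Qed.

(** This is how modalities are eliminated: on arguments with trivial extensions, a modality acts as
    one of its localizations. *)
Lemma localizeP (M : structure) k (phi : truth_table k) (s : 'I_k -> trivial)
    (A : 'I_k -> M -> Prop) (t : M) :
  (forall i x, A i x <-> trivial_set (s i) x) ->
  tt_sat (localize phi s) t (@no_sets M) <-> tt_sat phi t A.
Proof. by move=> As; apply: (@sat_subst M _ _ phi 0 (fun X => inl (s X)) _ A). Qed.

(** Sets are transported along the bijection as well, so set quantifiers are preserved. Relating the
    environments pointwise makes the hypotheses stable under [scons]. *)
Lemma sat_iso (M M' : structure) (h : M -> M') (h' : M' -> M) :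
  cancel h h' -> cancel h' h ->
  (forall x y, s_lt x y <-> s_lt (h x) (h y)) ->
  (forall x y, s_B x y <-> s_B (h x) (h y)) ->
  (forall x, s_P x <-> s_P (h x)) ->
  forall m p (f : mso m p) (e : 'I_m -> M) (e' : 'I_m -> M') E E',
  (forall i, e' i = h (e i)) -> (forall X x, E X x <-> E' X (h x)) ->
  sat f e E <-> sat f e' E'.
Proof.
move=> hK h'K hlt hB hP m p f.
elim: f => {m p} //= [m p i j|m p i j|m p i j|m p i|m p X i|m p f IHf|m p f IHf g IHg
  |m p f IHf|m p f IHf] e e' E E' ee' EE'; rewrite ?ee' //.
- by split=> [->|/(can_inj hK)].
- by rewrite (IHf _ _ _ _ ee' EE').
- by rewrite (IHf _ _ _ _ ee' EE') (IHg _ _ _ _ ee' EE').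
- have ext x i : scons (h x) e' i = h (scons x e i).
    by elim/ord_cases: i => [|i]; rewrite ?scons0 ?scons_lift.
  split=> -[x sx]; first by exists (h x); exact: (iffLR (IHf _ _ _ _ (ext x) EE')) sx.
  exists (h' x); move: sx; rewrite -{1}[x]h'K.
  exact: (iffRL (IHf _ _ _ _ (ext _) EE')).
- split=> -[A sA].
    (* The image of [A] under [h], written as a preimage under its inverse. *)
    exists (fun y => A (h' y)).
    apply: (iffLR (IHf e e' (scons A E) _ ee' _)) sA => X x.
    by elim/ord_cases: X => [|X]; rewrite ?scons0 ?scons_lift ?hK.
  exists (fun x => A (h x)).
  apply: (iffRL (IHf e e' _ (scons A E') ee' _)) sA => X x.
  by elim/ord_cases: X => [|X]; rewrite ?scons0 ?scons_lift.
Qed.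

(** * Automorphisms of the models *)

Section Stretch.
Variable R : realType.
Implicit Types c x y : R.

(* The Moebius map fixing 0 and 1 that multiplies the odds x / (1 - x) by c. *)
Definition odds_scale c x : R := c * x / (1 - x + c * x).

Lemma odds_scale_den c x : 0 < c -> 0 <= x < 1 -> 0 < 1 - x + c * x.
Proof. by move=> c0 /andP[x0 x1]; have := mulr_ge0 (ltW c0) x0; lra. Qed.

Lemma odds_scale_itv c x : 0 < c -> 0 <= x < 1 -> 0 <= odds_scale c x < 1.
Proof.
move=> c0 x01; have d0 := odds_scale_den c0 x01; have /andP[x0 x1] := x01.
rewrite /odds_scale (divr_ge0 (mulr_ge0 (ltW c0) x0) (ltW d0)) /=.
by rewrite ltr_pdivrMr //; lra.
Qed.

Lemma odds_scale_mono c x y :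
  0 < c -> 0 <= x < 1 -> 0 <= y < 1 -> x < y -> odds_scale c x < odds_scale c y.
Proof.
move=> c0 x01 y01 xy; have dx := odds_scale_den c0 x01.
have dy := odds_scale_den c0 y01.
rewrite /odds_scale ltr_pdivrMr // mulrAC ltr_pdivlMr // -subr_gt0.
(* After cross-multiplying, the terms in [x * y] cancel. *)
have -> : c * y * (1 - x + c * x) - c * x * (1 - y + c * y) = c * (y - x) by ring.
by rewrite mulr_gt0 // subr_gt0.
Qed.

Lemma odds_scaleK c x :
  0 < c -> 0 <= x < 1 -> odds_scale c^-1 (odds_scale c x) = x.
Proof.
move=> c0 x01; have d0 := odds_scale_den c0 x01.
rewrite /odds_scale; field.
by rewrite !gt_eqF //=; lra.
Qed.

Definition stretch c x : R :=
  (Num.floor x)%:~R + odds_scale c (x - (Num.floor x)%:~R).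

Lemma frac_itv x : 0 <= x - (Num.floor x)%:~R < 1.
Proof. by have := floor_itv x; rewrite intrD; lra. Qed.

Lemma floor_stretch c x : 0 < c -> Num.floor (stretch c x) = Num.floor x.
Proof.
move=> c0; apply: floor_def; have := odds_scale_itv c0 (frac_itv x).
by rewrite /stretch intrD; lra.
Qed.

Lemma stretchK c x : 0 < c -> stretch c^-1 (stretch c x) = x.
Proof.
move=> c0; rewrite {1}/stretch floor_stretch // /stretch [_ + _ - _]addrAC subrr.
by rewrite add0r odds_scaleK ?frac_itv // addrC subrK.
Qed.

Lemma stretch_mono c x y : 0 < c -> (stretch c x < stretch c y) = (x < y).
Proof.
(* On a total order a strictly increasing map also reflects the order, so one direction suffices. *)
move=> c0; apply: (leW_mono (le_mono _)) => {}x {}y xy.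
have := le_floor (ltW xy); rewrite le_eqVlt => /predU1P[fxy|fxy].
  rewrite /stretch fxy ltrD2l; apply: odds_scale_mono => //; rewrite ?frac_itv //.
    by rewrite -fxy frac_itv.
  by rewrite ltrD2r.
(* The floors differ, and each image stays in the unit interval of its argument. *)
have : (Num.floor x + 1)%:~R <= (Num.floor y)%:~R :> R.
  by rewrite ler_int -ltzD1 ltrD2r.
have := odds_scale_itv c0 (frac_itv x); have := odds_scale_itv c0 (frac_itv y).
by rewrite /stretch intrD; lra.
Qed.

(** Only the fractional part is distorted, and an integer shift does not change it. Compatibility
    with [s_B] rests on this. *)
Lemma stretchDz c x (m : int) : stretch c (x + m%:~R) = stretch c x + m%:~R.
Proof.
rewrite /stretch floorDrz ?intr_int // intrKfloor intrD.
rewrite opprD addrACA subrr addr0 addrAC //.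
Qed.

Lemma stretch_int c (m : int) : stretch c m%:~R = m%:~R.
Proof. by rewrite /stretch intrKfloor subrr /odds_scale mulr0 mul0r addr0. Qed.

End Stretch.

(** * The two automorphism orbits of a model *)

Section Models.
Variables (R : realType) (k : nat).
Hypothesis k_gt0 : (0 < k)%N.
Let M := model R k.

Let kR0 : k%:R != 0 :> R.
Proof. by rewrite pnatr_eq0 -lt0n. Qed.

Let kR_gt0 : 0 < k%:R :> R.
Proof. by rewrite ltr0n. Qed.

Definition model_aut (c : R) (j : int) (x : R) : R :=
  (stretch c (x * k%:R) + j%:~R) / k%:R.

(** Multiplication by [k] turns [s_P] into the integers and the unit shift [s_B] into the shift by
    the integer [k]. Stretching and integer translation respect both. *)
Lemma model_aut_sat (c : R) (j : int) (f : mso 1 0) (t : R) : 0 < c ->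
  @tt_sat M 0 f t (@no_sets M) <-> @tt_sat M 0 f (model_aut c j t) (@no_sets M).
Proof.
move=> c0; have ci0 : 0 < c^-1 by rewrite invr_gt0.
pose h' (x : R) : R := stretch c^-1 (x * k%:R - j%:~R) / k%:R.
have hK : cancel (model_aut c j) h'.
  by move=> x; rewrite /h' /model_aut divfK // addrK stretchK // mulfK.
have h'K : cancel h' (model_aut c j).
  move=> x; rewrite /h' /model_aut divfK // -{1}[c]invrK stretchK //.
  by rewrite subrK mulfK.
apply: (@sat_iso M M (model_aut c j) h' hK h'K) => // [x y|x y|x] /=.
- by rewrite /model_aut ltr_pM2r ?invr_gt0 // ltrD2r stretch_mono // ltr_pM2r.
- have shift z : model_aut c j (z + 1) = model_aut c j z + 1.
    by rewrite /model_aut [(z + 1) * _]mulrDl mul1r -[k%:R]/(k%:Z%:~R) stretchDz; field.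
  by split=> [->|]; rewrite ?shift // -shift => /(can_inj hK).
- split=> -[m] => [->|hx].
    by exists (m + j); rewrite /model_aut divfK // stretch_int intrD.
  exists (m - j); apply: (can_inj hK); rewrite hx /model_aut divfK //.
  by rewrite stretch_int -intrD subrK.
Qed.

Definition half_step : R := 2^-1 / k%:R.

Lemma half_step_notP : ~ @s_P M half_step.
Proof.
(* Otherwise one half would be an integer strictly between 0 and 1. *)
case=> m /(mulIf (invr_neq0 kR0)) hm.
have m0 : 0 < m%:~R :> R by rewrite -hm invr_gt0.
have m1 : m%:~R < 1 :> R by rewrite -hm invf_lt1 ?ltr1n.
by move: m0 m1; rewrite ltr0z ltrz1; lia.
Qed.

Lemma zero_P : @s_P M 0.
Proof. by exists 0; rewrite mul0r. Qed.

Lemma sat_orbit (f : mso 1 0) (t t' : M) : (s_P t <-> s_P t') ->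
  @tt_sat M 0 f t (@no_sets M) <-> @tt_sat M 0 f t' (@no_sets M).
Proof.
(* The chosen orbit representative depends only on whether [u] satisfies [s_P]. *)
suff rep u : @tt_sat M 0 f u (@no_sets M) <->
    @tt_sat M 0 f (if `[< @s_P M u >] then 0 else half_step : R) (@no_sets M).
  by move=> tt'; rewrite (rep t) (rep t') (asbool_equiv_eq tt').
case: asboolP => [[m ->]|Pu].
  rewrite (@model_aut_sat 1 (- m) f (m%:~R / k%:R)) //.
  by rewrite /model_aut divfK // stretch_int -intrD subrr mul0r.
set m := Num.floor (u * k%:R); set x := u * k%:R - m%:~R.
have x01 : 0 < x < 1.
  have /andP[x0 x1] := frac_itv (u * k%:R); rewrite x1 andbT lt0r x0 andbT.
  apply/eqP => /subr0_eq um; apply: Pu; exists m.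
  by rewrite -[LHS](mulfK kR0) um.
(* The factor [(1 - x) / x] is the inverse of the odds of [x]. It brings them to 1, which sends [x]
   to one half. *)
have c0 : 0 < (1 - x) / x by rewrite divr_gt0 //; lra.
rewrite (@model_aut_sat _ (- m) f u c0) /model_aut /stretch -/m -/x.
rewrite addrAC -intrD subrr add0r.
suff -> : odds_scale ((1 - x) / x) x = 2^-1 by [].
rewrite /odds_scale; field; apply/andP; split; apply/eqP; lra.
Qed.

(* A property invariant under automorphisms is determined by its values at the
   representatives 0 and 1/(2k) of the two orbits. *)
Definition orbit_code (f : mso 1 0) : bool * bool :=
  (`[< @tt_sat M 0 f 0 (@no_sets M) >],
   `[< @tt_sat M 0 f half_step (@no_sets M) >]).

Definition trivial_code (c : trivial) : bool * bool :=
  match c with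
  | TrTrue => (true, true) | TrFalse => (false, false)
  | TrP => (true, false) | TrNotP => (false, true)
  end.

Lemma trivial_codeP c : trivial_code c =
  (`[< @trivial_set M c 0 >], `[< @trivial_set M c half_step >]).
Proof.
have P0 := zero_P; have Ph := half_step_notP.
by case: c => /=; congr (_, _); symmetry; apply/asboolP; tauto.
Qed.

(** Triviality becomes an equation between pairs of booleans, whose type does not depend on the
    model; the pigeonhole argument needs this. *)
Lemma mso_equiv_trivialP f c :
  mso_equiv_trivial M f c <-> orbit_code f = trivial_code c.
Proof.
have fc t : tt_sat (trivial_mso 0 c ord0) t (@no_sets M) = trivial_set c t.
  exact: sat_trivial_mso.
rewrite trivial_codeP; split=> [eqf|].
  by rewrite /orbit_code; congr (_, _); apply: asbool_equiv_eq; rewrite eqf fc.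
case=> e0 eh t; rewrite fc; move: (asbool_eq_equiv e0) (asbool_eq_equiv eh) => {}e0 {}eh.
have cP (u : M) : (s_P t <-> s_P u) -> trivial_set c t <-> trivial_set c u.
  by case: c {fc e0 eh} => /=; tauto.
have [Pt|Pt] := EM (s_P t).
  have t0 : s_P t <-> @s_P M 0 by split=> // _; apply: zero_P.
  by rewrite (sat_orbit f t0) (cP _ t0).
have t0 : s_P t <-> @s_P M half_step by split=> // /half_step_notP.
by rewrite (sat_orbit f t0) (cP _ t0).
Qed.

Lemma mso_trivial f : exists c, mso_equiv_trivial M f c.
Proof.
case def_b: (orbit_code f) => [[] []]; [exists TrTrue|exists TrP|exists TrNotP|exists TrFalse];
  exact/mso_equiv_trivialP.
Qed.

(** Both orbits are nonempty, so the four trivial sets are distinct in every model. *)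
Lemma trivial_set_inj c c' :
  (forall t : M, trivial_set c t <-> trivial_set c' t) -> c = c'.
Proof.
move=> cc'; suff : trivial_code c = trivial_code c' by case: c {cc'}; case: c'.
by rewrite !trivial_codeP; congr (_, _); apply: asbool_equiv_eq.
Qed.

End Models.

(** * Temporal formulas in two models with matching localizations *)

Lemma trivial_set_not c : exists d, forall (M : structure) (t : M),
  trivial_set d t <-> ~ trivial_set c t.
Proof.
case: c; [exists TrFalse|exists TrTrue|exists TrNotP|exists TrP] => M t /=; try tauto.
by have := EM (s_P t); tauto.
Qed.

(** As in [trivial_set_not], [d] is chosen before the structure, so one trivial form serves both
    models. *)
Lemma trivial_set_and c c' : exists d, forall (M : structure) (t : M),
  trivial_set d t <-> trivial_set c t /\ trivial_set c' t.
Proof.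
case: c; case: c'; first [exists TrTrue => M t /=; tauto | exists TrFalse => M t /=; tauto
  | exists TrP => M t /=; tauto | exists TrNotP => M t /=; tauto].
Qed.

Section TwoModels.
Variables (R : realType) (n k l : nat).
Hypotheses (k_gt0 : (0 < k)%N) (l_gt0 : (0 < l)%N).
Hypothesis same_S : forall g, in_S n g -> ~ mso_differ (model R k) (model R l) g.

Lemma same_trivial_S g : in_S n g -> exists c,
  mso_equiv_trivial (model R k) g c /\ mso_equiv_trivial (model R l) g c.
Proof.
move=> /same_S gS; have [c gc] := mso_trivial R k_gt0 g.
have [c' gc'] := mso_trivial R l_gt0 g.
exists c; split=> //; have [->//|ncc'] := EM (c = c').
by case: gS; exists c, c'.
Qed.

Lemma same_trivial (f : tlP n) : exists c,
  tl_equiv_trivial (model R k) f c /\ tl_equiv_trivial (model R l) f c.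
Proof.
suff [c [fk fl]] : exists c,
    (forall t : model R k, tlP_sat f t <-> trivial_set c t) /\
    (forall t : model R l, tlP_sat f t <-> trivial_set c t).
  by exists c; split=> t; rewrite tlP_sat_trivial.
elim: f => [||[]|f [c [fk fl]]|f [c [fk fl]] g [d [gk gl]]|p phi dphi a IHa].
- by exists TrTrue.
- by exists TrP.
- have [d dP] := trivial_set_not c.
  by exists d; split=> t; rewrite dP -?fk -?fl.
- have [e eP] := trivial_set_and c d.
  by exists e; split=> t; rewrite eP -?fk -?fl -?gk -?gl.
(* The induction hypothesis gives each argument one form valid in both models; collecting these
   forms singles out one localization. *)
have [s sP] := fin_all_exists IHa.
have [|c [ck cl]] := @same_trivial_S (localize phi s); first by exists p, phi, s.
exists c; split=> t; rewrite -mso_equiv_trivial_set; try eassumption;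
  rewrite (@localizeP _ _ phi s (fun i => tlP_sat (a i))) // => i x.
  exact: (sP i).1.
exact: (sP i).2.
Qed.

Lemma tl_not_differ (f : tlP n) : ~ tl_differ (model R k) (model R l) f.
Proof.
case=> c [c' [cc' fc fc']]; have [d [fd fd']] := same_trivial f; apply: cc'.
transitivity d; [apply: (@trivial_set_inj R _ k_gt0)|apply: (@trivial_set_inj R _ l_gt0)] => t.
  by rewrite -!(@tlP_sat_trivial _ n) -(fd t) (fc t).
by rewrite -!(@tlP_sat_trivial _ n) -(fd' t) (fc' t).
Qed.

End TwoModels.

(** * Finiteness of the localizations and the pigeonhole argument *)

Lemma S_finite n : exists (N : nat) (h : 'I_N -> mso 1 0),
  (forall i, in_S n (h i)) /\
  forall g, in_S n g -> exists i, logically_equivalent g (h i).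
Proof.
pose s := depth_reps n 1 0; exists (size s), (fun i => nth FTrue s i); split=> [i|g gS].
  by apply/depth_in_S/depth_reps_depth; apply: nth_In.
have [h [hs gh]] := depth_reps_complete (in_S_depth gS).
have [i ih] := In_nth FTrue hs.
by exists i; rewrite ih => M t; apply: gh.
Qed.

Lemma indistinguishable_models (R : realType) n : exists k l : nat,
  [/\ (0 < k)%N, (k < l)%N &
   forall g, in_S n g -> ~ mso_differ (model R k) (model R l) g].
Proof.
have [N [h [_ hP]]] := S_finite n.
(* Each model is recorded by the orbit codes of the representatives [h i], and there is one more
   model than there are possible records. The successor [k.+1] keeps the model parameter
   positive. *)
pose F (k : 'I_(#|{ffun 'I_N -> bool * bool}|.+1)) :=
  [ffun i => orbit_code R k.+1 (h i)].
have /injectivePn[k0 [l0 kl0 eF0]] : ~~ injectiveb F.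
  by apply/injectiveP => /leq_card; rewrite card_ord ltnn.
wlog kl : k0 l0 kl0 eF0 / (k0 < l0)%N.
  move=> W; case: (ltngtP k0 l0) => [||/val_inj kl]; first exact: W.
    by apply: W => //; rewrite eq_sym.
  by rewrite kl eqxx in kl0.
exists k0.+1, l0.+1; split=> // g gS [c [c' [cc' gc gc']]]; apply: cc'.
have [i gi] := hP _ gS.
have hc : mso_equiv_trivial (model R k0.+1) (h i) c by move=> t; rewrite -gi.
have hc' : mso_equiv_trivial (model R l0.+1) (h i) c' by move=> t; rewrite -gi.
have codes : trivial_code c = trivial_code c'.
  rewrite -(iffLR (mso_equiv_trivialP R (ltn0Sn _) _ _) hc).
  rewrite -(iffLR (mso_equiv_trivialP R (ltn0Sn _) _ _) hc').
  by move/ffunP/(_ i): eF0; rewrite !ffunE.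
by move: codes; case: c {gc hc}; case: c' {gc' hc'}.
Qed.

(** * Counting points of P *)

(** After scaling by [k], the points counted become integers strictly between [t * k] and
    [t * k + k], of which there are at most [k]. *)
Lemma counting_P_small (R : realType) (k l : nat) (t : R) :
  (0 < k)%N -> counting l (@s_P (model R k)) t -> (l <= k)%N.
Proof.
case: k => // k _ [u [u_inj uP]]; set K := k.+1 in uP *.
have k0 : 0 < K%:R :> R by rewrite ltr0n.
(* The offset makes 0 the number of the first integer above [t * K]. *)
pose v i := Num.floor (u i * K%:R) - Num.floor (t * K%:R) - 1.
have uE i : u i = (Num.floor (u i * K%:R))%:~R / K%:R.
  have [_ [m um]] := uP i.
  by rewrite um divfK ?gt_eqF // intrKfloor.
have v_itv i : 0 <= v i < K%:Z.
  have [/andP[tu ut] _] := uP i; move: tu ut; rewrite /v uE.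
  set m := Num.floor (u i * K%:R) => tm mt.
  have lo : Num.floor (t * K%:R) < m by rewrite floor_lt_int -ltr_pdivlMr.
  have hi : m < Num.floor (t * K%:R) + 1 + K%:Z.
    rewrite -(@ltr_int R) intrD.
    have tK := floorD1_gt (t * K%:R); move: mt; rewrite ltr_pdivrMr // mulrDl mul1r.
    by move=> mt; apply: lt_trans mt _; rewrite ltrD2r.
  by rewrite divfK ?gt_eqF // intrKfloor; lia.
(* By [v_itv] the number is below [K], so [inord] never falls back to its default. *)
pose w i : 'I_K := inord `|v i|%N.
have w_inj : injective w.
  move=> i j /(congr1 (@nat_of_ord K)); rewrite /w !inordK;
    try by have := v_itv i; have := v_itv j; lia.
  move=> vij; have {}vij : v i = v j by have := v_itv i; have := v_itv j; lia.
  by apply: u_inj; rewrite [LHS]uE [RHS]uE; move/addIr/addIr: vij => ->.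
by have := leq_card w w_inj; rewrite !card_ord.
Qed.

Lemma counting_P_half_step (R : realType) (l : nat) :
  (0 < l)%N -> counting l (@s_P (model R l)) (half_step R l).
Proof.
move=> l_gt0; have l0 : 0 < l%:R :> R by rewrite ltr0n.
(* The points are 1/l, 2/l, ..., 1; starting at 1/(2l) puts all of them strictly inside the unit
   interval. *)
exists (fun i : 'I_l => i.+1%:R / l%:R); split=> [i j|i].
  by move/(mulIf (invr_neq0 (lt0r_neq0 l0)))/eqP; rewrite eqr_nat eqSS => /eqP/val_inj.
split; last by exists i.+1%:Z.
have il : i.+1%:R <= l%:R :> R by rewrite ler_nat.
have i1 : 1 <= i.+1%:R :> R by rewrite ler1n.
rewrite /half_step ltr_pM2r ?invr_gt0 // -[X in _ + X](divff (lt0r_neq0 l0)) -mulrDl.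
by rewrite ltr_pM2r ?invr_gt0 //; apply/andP; split; lra.
Qed.

(** A formula expressing [C_k(X)] does so also when every predicate name is read as [P]. This
    translation then yields a formula over [P] alone, to which [same_trivial] applies. *)
Fixpoint vars_to_P n V (f : tl n V) : tlP n :=
  match f with
  | TTrue => TTrue
  | TP => TP
  | TVar _ => TP
  | TNot f => TNot (vars_to_P f)
  | TAnd f g => TAnd (vars_to_P f) (vars_to_P g)
  | TMod _ _ hphi a => TMod hphi (fun i => vars_to_P (a i))
  end.

(** The identity is an isomorphism. *)
Lemma sat_ext (M : structure) m p (f : mso m p) (e : 'I_m -> M) E E' :
  (forall X x, E X x <-> E' X x) -> sat f e E <-> sat f e E'.
Proof. by apply: (@sat_iso M M id id). Qed.

Lemma vars_to_P_sat (M : structure) n V (f : tl n V) (t : M) :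
  tlP_sat (vars_to_P f) t <-> tl_sat (fun=> @s_P M) f t.
Proof.
elim: f t => //= [f IHf|f IHf g IHg|p phi dphi a IHa] t.
- by have := IHf t; rewrite /tlP_sat /=; tauto.
- by have := IHf t; have := IHg t; rewrite /tlP_sat /=; tauto.
by apply: sat_ext => i x; apply: IHa.
Qed.

Theorem theorem4p3 (R : realType) (n : nat) :
  (forall k l : nat, (0 < k)%N -> (0 < l)%N ->
     (exists f : tlP n, tl_differ (model R k) (model R l) f) ->
     exists g : mso 1 0, in_S n g /\ mso_differ (model R k) (model R l) g)
  /\
  (exists (N : nat) (h : 'I_N -> mso 1 0),
     (forall i, in_S n (h i)) /\
     forall g, in_S n g -> exists i, logically_equivalent g (h i))
  /\
  (exists k l : nat,
     [/\ (0 < k)%N, (0 < l)%N, k <> l &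
      forall f : tlP n, exists c : trivial,
        tl_equiv_trivial (model R k) f c /\ tl_equiv_trivial (model R l) f c])
  /\
  (exists k : nat, (0 < k)%N /\ ~ counting_expressible R n k).
Proof.
have [k [l [k_gt0 kl same_S]]] := indistinguishable_models R n.
have l_gt0 := ltn_trans k_gt0 kl.
split; [|split; [exact: S_finite|split]].
- move=> k' l' k'_gt0 l'_gt0 [f fdiff]; apply: contrapT => noS.
  by apply: (tl_not_differ k'_gt0 l'_gt0 _ fdiff) => g gS gdiff; apply: noS; exists g.
- exists k, l; split=> // [kE|]; first by rewrite kE ltnn in kl.
  exact: same_trivial.
(* The larger index [l] is the one that fails: [C_l(P)] separates the two models although
   [vars_to_P f] cannot. *)
exists l; split=> // -[f fP].
have [c [fk fl]] := same_trivial k_gt0 l_gt0 same_S (vars_to_P f).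
have falseE : c = TrFalse.
  apply: (@trivial_set_inj R _ k_gt0) => t.
  rewrite -(@tlP_sat_trivial _ n) -(fk t) vars_to_P_sat.
  rewrite [X in X <-> _](fP (@s_P (model R k)) (fun=> @s_P (model R k))) /=.
  by split=> // ct; have := counting_P_small k_gt0 ct; rewrite leqNgt kl.
have := counting_P_half_step R l_gt0.
move=> /(fP (@s_P (model R l)) (fun=> @s_P (model R l))).
by move=> /(@vars_to_P_sat (model R l)) /fl; rewrite falseE; apply.
Qed.
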